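(* Let $\mathbb{S}$ be a metric space, let $\{\mu_n\}_{n\ge 1}$ be a sequence of measures on $\mathbb{S}$ that converges weakly to a finite measure $\mu$ on $\mathbb{S}$, let $\{f_n\}_{n\ge 1}$ be a sequence of lower semi-continuous $[-\infty,+\infty]$-valued functions on $\mathbb{S}$ such that $f_n(s)\le f_{n+1}(s)$ for each $n\ge 1$ and $s\in\mathbb{S}$, and let $f(s):=\lim_{n\to\infty} f_n(s)$, $s\in\mathbb{S}$. Assume the integrals $\int_{\mathbb{S}} f_n\,d\mu_n$ are defined. If (i) the function $f$ is upper semi-continuous; and (ii) the functions $f_1^-$ and $f^+$ are asymptotically uniformly integrable with respect to $\{\mu_n\}_{n\ge 1}$; then $$\lim_{n\to\infty}\int_{\mathbb{S}} f_n(s)\,\mu_n(ds)=\int_{\mathbb{S}} f(s)\,\mu(ds).$$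
   Context: Metric spaces carry their Borel $\sigma$-field. For a function $h$, $h^+=\max\{h,0\}$ and $h^-=-\min\{h,0\}$. The integral $\int h\,d\mu$ of a measurable $[-\infty,+\infty]$-valued function is defined if $\min\{\int h^+d\mu,\int h^-d\mu\}<+\infty$, and then equals $\int h^+d\mu-\int h^-d\mu$. Weak convergence: $\{\mu_n\}$ converges weakly to a finite measure $\mu$ if $\int h\,d\mu_n\to\int h\,d\mu$ for every bounded continuous function $h$ on $\mathbb{S}$ (so $\mu_n$ is finite for all sufficiently large $n$). A single function $h$ is asymptotically uniformly integrable with respect to $\{\mu_n\}$ if $\lim_{K\to+\infty}\limsup_{n\to\infty}\int |h(s)|\,\mathbf{1}\{|h(s)|\ge K\}\,\mu_n(ds)=0$. *)

(* Defs.v *)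
From HB Require Import structures.
From mathcomp Require Import all_boot all_order all_algebra.
From mathcomp Require Import all_classical all_reals all_analysis.

Set Implicit Arguments.
Unset Strict Implicit.
Unset Printing Implicit Defensive.

Import Order.TTheory GRing.Theory Num.Theory.
Import numFieldNormedType.Exports.

Local Open Scope classical_set_scope.
Local Open Scope ring_scope.
Local Open Scope ereal_scope.

(* The library's measurable types are pointed, whereas [metricType] is not;
   this join is what allows a metric space to carry its Borel sigma-field. *)
#[short(type="pmetricType")]
HB.structure Definition PMetric (K : numDomainType) :=
  {M of Pointed M & Metric K M}.

Definition borel (R : realType) (S : pmetricType R) :=
  g_sigma_algebraType (@open S).

Definition upper_semicontinuous (X : topologicalType) (R : numFieldType)
    (f : X -> \bar R) :=
  forall x a, f x < a%:E -> exists2 V, nbhs x V & forall y, V y -> f y < a%:E.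

Definition integral_defined d (T : measurableType d) (R : realType)
    (mu : {measure set T -> \bar R}) (h : T -> \bar R) :=
  Order.min (\int[mu]_x h^\+ x) (\int[mu]_x h^\- x) < +oo.

(* The [mu_ n] may be infinite: taking [h = 1] forces them to be finite for
   all large [n], so the integrals below are all defined from some rank on. *)
Definition weak_cvg (R : realType) (S : pmetricType R)
    (mu_ : nat -> {measure set (borel S) -> \bar R})
    (mu : {finite_measure set (borel S) -> \bar R}) :=
  forall h : S -> R, continuous h -> bounded_fun h ->
    \int[mu_ n]_s (h s)%:E @[n --> \oo] --> \int[mu]_s (h s)%:E.

Definition asymptotically_uniformly_integrable d (T : measurableType d)
    (R : realType) (mu_ : nat -> {measure set T -> \bar R})
    (h : T -> \bar R) :=
  limn_esup (fun n => \int[mu_ n]_(s in [set s | K%:E <= `|h s|]) `|h s|)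
    @[K --> +oo%R] --> 0.

(* Main.v *)
(* As an increasing limit of lower semicontinuous functions, f is lower
   semicontinuous, hence continuous into [-oo, +oo]. Let c_K truncate values to
   [-K, K], and let phi_m(x) = inf_y (c_K (f_m y) + m d(x, y)), which is
   m-Lipschitz, bounded by K, below c_K (f_m), and converges pointwise to
   c_K (f). For n >= m,
     phi_m - f_0^- 1{f_0^- >= K} <= f_n <= c_K (f) + f^+ 1{f^+ >= K}.
   Integrate against mu_n: weak convergence applies to the bounded continuous
   functions phi_m and c_K (f), and the two tails are uniformly small for K
   large. Letting m, and then K, go to infinity with dominated convergence
   under mu closes the gap; f is mu-integrable because the integrals of the
   |c_M (f)| are bounded uniformly in M. *)
Require Import Defs.
From HB Require Import structures.
From mathcomp Require Import all_boot all_order all_algebra.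
From mathcomp Require Import all_classical all_reals all_analysis.
From mathcomp Require Import measurable_realfun lra.

Set Implicit Arguments.
Unset Strict Implicit.
Unset Printing Implicit Defensive.

Import Order.TTheory GRing.Theory Num.Theory.
Import numFieldNormedType.Exports.

Local Open Scope classical_set_scope.
Local Open Scope ring_scope.
Local Open Scope ereal_scope.

(** * Semicontinuity and Borel measurability *)

Lemma nondecreasing_cvg_lsc (R : realType) (X : topologicalType)
    (f_ : nat -> X -> \bar R) (f : X -> \bar R) :
  (forall n, lower_semicontinuous (f_ n)) ->
  (forall n s, f_ n s <= f_ n.+1 s) ->
  (forall s, f_ n s @[n --> \oo] --> f s) ->
  lower_semicontinuous f /\ forall n s, f_ n s <= f s.
Proof.
move=> f_lsc f_nd f_lim.
have f_le n s : f_ n s <= f s.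
  have nd : nondecreasing_seq (f_ ^~ s) by exact/nondecreasing_seqP.
  rewrite -(cvg_lim _ (f_lim s))//; apply: lime_ge.
    by apply/cvg_ex; exists (f s); exact: f_lim.
  by exists n => // m /= nm; exact: nd.
split=> // x a afx.
(* A strict bound below the limit already holds for some [f_ n], whose neighbourhood then serves for
   [f] by [f_le]. *)
have [n an] : exists n, a%:E < f_ n x.
  have [n _ an] := f_lim x _ (open_ereal_gt' afx).
  by exists n; exact: (an n (leqnn n)).
have [V xV aV] := f_lsc n x a an.
by exists V => // y /aV /lt_le_trans; apply.
Qed.

(** The rays []a, +oo]] generate the Borel sets of the extended line, and their preimages under [h]
    are open. *)
Lemma lsc_measurable (R : realType) (S : pmetricType R) (h : S -> \bar R) :
  lower_semicontinuous h ->
  measurable_fun [set: borel S] h.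
Proof.
move=> sch; apply: (measurability _ (ErealGenOInfty.measurableE R)).
move=> /= _ [_ [a ->]] <-; apply: measurableI => //; apply: sub_sigma_algebra.
by rewrite preimage_itvoy; move/lower_semicontinuousP : sch; exact.
Qed.

Lemma continuous_lsc (R : realType) (X : topologicalType) (h : X -> R) :
  continuous h -> lower_semicontinuous (EFin \o h).
Proof.
move=> ch x a /=; rewrite lte_fin => ahx.
exists [set y | (a < h y)%R]; last by move=> y /=; rewrite lte_fin.
exact: (cvgr_gt _ (ch x) _ ahx).
Qed.

Lemma continuous_borel_measurable (R : realType) (S : pmetricType R)
    (h : S -> R) :
  continuous h -> measurable_fun [set: borel S] h.
Proof.
move=> ch; apply/measurable_EFinP; apply: lsc_measurable.
exact: continuous_lsc.
Qed.

(** * Truncation of extended reals *)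

(** Real-valued, so that truncations can serve as test functions for weak convergence; [fine] loses
    nothing, since the clamped value is finite. *)
Definition clip (R : realType) (K : R) (x : \bar R) : R :=
  fine (maxe (- K%:E) (mine x K%:E)).

Section clip.
Context {R : realType}.
Implicit Types (K a : R) (x : \bar R).

Lemma clipE K x : (0 <= K)%R -> (clip K x)%:E = maxe (- K%:E) (mine x K%:E).
Proof.
move=> K0; rewrite /clip; case: x => [r| |].
- by rewrite -!EFin_min -!EFin_max.
- by rewrite minye -EFin_max.
- by rewrite minNye maxeNy.
Qed.

(** With [clip_lt], this reduces semicontinuity of a truncation to that of the truncated function:
    the comparisons not involving [x] hold at every point or at none. *)
Lemma lt_clip K x a : (0 <= K)%R ->
  (a%:E < (clip K x)%:E) = (a%:E < (- K)%:E) || ((a%:E < x) && (a%:E < K%:E)).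
Proof. by move=> K0; rewrite clipE// lt_max lt_min. Qed.

Lemma clip_lt K x a : (0 <= K)%R ->
  ((clip K x)%:E < a%:E) = ((- K)%:E < a%:E) && ((x < a%:E) || (K%:E < a%:E)).
Proof. by move=> K0; rewrite clipE// gt_max gt_min. Qed.

Lemma clip_itv K x : (0 <= K)%R -> (- K <= clip K x <= K)%R.
Proof.
move=> K0; rewrite -!lee_fin clipE// le_max lexx/= ge_max ge_min lexx orbT.
by rewrite lee_fin andbT; lra.
Qed.

Lemma clip_norm K x : (0 <= K)%R -> (`|clip K x| <= K)%R.
Proof. by move=> K0; rewrite ler_norml clip_itv. Qed.

Lemma le_clip K : (0 <= K)%R -> {homo clip K : x y / x <= y >-> (x <= y)%R}.
Proof.
move=> K0 x y xy; rewrite -lee_fin !clipE// ge_max le_max lexx/= le_max.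
by apply/orP; right; rewrite le_min !ge_min xy lexx orbT.
Qed.

Lemma clip_id K r : (`|r| <= K)%R -> clip K r%:E = r.
Proof.
move=> rK; have K0 : (0 <= K)%R by exact: le_trans rK.
move: rK; rewrite ler_norml => /andP[Kr rK]; apply: EFin_inj.
by rewrite clipE// min_l ?lee_fin// max_r ?lee_fin.
Qed.

Lemma clip_pinfty K : (0 <= K)%R -> clip K +oo = K.
Proof.
move=> K0; apply: EFin_inj; rewrite clipE// minye max_r// lee_fin; lra.
Qed.

Lemma clip_ninfty K : (0 <= K)%R -> clip K -oo = (- K)%R.
Proof. by move=> K0; apply: EFin_inj; rewrite clipE// minNye maxeNy. Qed.

Lemma abse_clip_le K x : (0 <= K)%R -> `|(clip K x)%:E| <= `|x|.
Proof.
move=> K0; case: x => [r| |]; rewrite ?leey//=.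
rewrite lee_fin; have [rK|Kr] := leP `|r|%R K; first by rewrite clip_id.
exact: le_trans (clip_norm _ K0) (ltW Kr).
Qed.

(** A real is left fixed once [n] reaches its modulus; at the infinities the truncation is [n] or
    [- n]. *)
Lemma cvg_clip x : (clip n%:R x)%:E @[n --> \oo] --> x.
Proof.
case: x => [r| |].
- apply: cvg_near_cst; near=> n; rewrite clip_id//.
  by near: n; exact: nbhs_infty_ger.
- under eq_fun do rewrite clip_pinfty//.
  exact/cvgenyP.
- under eq_fun do rewrite clip_ninfty// EFinN.
  exact/cvgNeNy/cvgenyP.
Unshelve. all: by end_near. Qed.

Lemma clip_lsc (X : topologicalType) (h : X -> \bar R) K : (0 <= K)%R ->
  lower_semicontinuous h -> lower_semicontinuous (EFin \o (clip K \o h)).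
Proof.
move=> K0 sch x a /=; rewrite lt_clip// => /orP[aK|/andP[/sch[V xV aV] aK]].
  by exists setT => [|y _]; [exact: filterT|rewrite lt_clip// aK].
by exists V => // y /aV ay; rewrite lt_clip// ay aK orbT.
Qed.

(** Each semicontinuity gives one side of the [e]-neighbourhood of the value. Upper semicontinuity
    of the limit function enters the proof through this lemma. *)
Lemma clip_continuous (X : topologicalType) (h : X -> \bar R) K : (0 <= K)%R ->
  lower_semicontinuous h -> upper_semicontinuous h ->
  continuous (clip K \o h).
Proof.
move=> K0 lsch usch x; apply/cvgrPdist_lt => e e0 /=.
have lo : \forall y \near x, (clip K (h x) - e < clip K (h y))%R.
  have : (clip K (h x) - e)%:E < (clip K (h x))%:E by rewrite lte_fin; lra.
  move=> /(@clip_lsc _ _ K K0 lsch)[V xV aV].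
  by apply: filterS xV => y /aV; rewrite lte_fin.
have up : \forall y \near x, (clip K (h y) < clip K (h x) + e)%R.
  have : (clip K (h x))%:E < (clip K (h x) + e)%:E by rewrite lte_fin; lra.
  (* Either [h x] is below the target and semicontinuity applies, or [K] is and the bound holds
     everywhere. *)
  rewrite clip_lt// => /andP[Ke] /orP[/usch[V xV aV]|K'e].
    apply: filterS xV => y /aV ye.
    by rewrite -lte_fin clip_lt// Ke ye.
  by apply: nearW => y; rewrite -lte_fin clip_lt// Ke K'e orbT.
by apply: filterS2 lo up => y ? ?; rewrite ltr_norml; apply/andP; split; lra.
Qed.

End clip.

(** * Lipschitz regularization of functions bounded below *)

(** The Pasch-Hausdorff envelope. [inf] is a genuine infimum only on sets bounded below, whence the
    bound [- K <= h z] in the lemmas. *)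
Definition lip_reg (R : realType) (S : metricType R) (m : R) (h : S -> R)
    (x : S) : R :=
  inf [set (h y + m * mdist x y)%R | y in [set: S]].

Section lip_reg.
Context {R : realType} {S : metricType R}.
Implicit Types (h : S -> R) (m K : R).
Local Open Scope ring_scope.

Lemma lip_reg_ge m h c x :
  (forall y, c <= h y + m * mdist x y) -> c <= lip_reg m h x.
Proof.
move=> ch; apply: lb_le_inf; first by exists (h x + m * mdist x x), x.
by move=> _ [y _ <-].
Qed.

Lemma lip_reg_ub m h K x y : 0 <= m -> (forall z, - K <= h z) ->
  lip_reg m h x <= h y + m * mdist x y.
Proof.
move=> m0 Kh; apply: ge_inf; last by exists y.
by exists (- K) => _ [z _ <-]; rewrite ler_wpDr// mulr_ge0// mdist_ge0.
Qed.

Lemma lip_reg_le m h K x : 0 <= m -> (forall z, - K <= h z) ->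
  lip_reg m h x <= h x.
Proof.
by move=> m0 Kh; have := lip_reg_ub x x m0 Kh; rewrite mdistxx mulr0 addr0.
Qed.

(** The infimum over [z] of [h z + m d(x, z) <= h z + m d(y, z) + m d(x, y)]. *)
Lemma lip_reg_lipschitz m h K x y : 0 <= m -> (forall z, - K <= h z) ->
  lip_reg m h x <= lip_reg m h y + m * mdist x y.
Proof.
move=> m0 Kh; rewrite -lerBlDr; apply: lip_reg_ge => z.
have := lip_reg_ub x z m0 Kh.
have := ler_wpM2l m0 (metric_triangle x y z); rewrite mulrDr; lra.
Qed.

Lemma lip_reg_continuous m h K : 0 <= m -> (forall z, - K <= h z) ->
  continuous (lip_reg m h).
Proof.
move=> m0 Kh x; apply/cvgrPdist_lt => e e0.
(* The divisor is [m + 1] because [m] may be zero. *)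
have d0 : 0 < e / (m + 1) by rewrite divr_gt0// ltr_wpDl.
apply: filterS (nbhsx_ballx x _ d0) => y; rewrite ballEmdist/=.
rewrite ltr_pdivlMr ?ltr_wpDl// => xye.
have xy := lip_reg_lipschitz x y m0 Kh.
have := lip_reg_lipschitz y x m0 Kh; rewrite metric_sym => yx.
have xy0 : 0 <= mdist x y by exact: mdist_ge0.
by rewrite ltr_norml; apply/andP; split; nra.
Qed.

(* If [h_ n0 > g x - e] on the ball of radius [d] around [x], then outside
   that ball the penalty [n d >= 2 K] alone keeps [h_ n y + n d(x, y)] above
   [g x]. *)
Lemma lip_reg_cvg (h_ : nat -> S -> R) (g : S -> R) K :
  (forall n x, - K <= h_ n x <= K) ->
  (forall n, lower_semicontinuous (EFin \o h_ n)) ->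
  (forall x, nondecreasing_seq (h_ ^~ x)) ->
  (forall x, h_ n x @[n --> \oo] --> g x) ->
  forall x, lip_reg n%:R (h_ n) x @[n --> \oo] --> g x.
Proof.
move=> hK h_lsc h_nd h_cvg x.
have Kh n z : - K <= h_ n z by have /andP[] := hK n z.
have h_le n z : h_ n z <= g z.
  rewrite -(cvg_lim _ (h_cvg z))//; apply: limr_ge.
    by apply/cvg_ex; exists (g z); exact: h_cvg.
  by exists n => // m /= nm; exact: h_nd.
have gK : g x <= K.
  rewrite -(cvg_lim _ (h_cvg x))//; apply: limr_le.
    by apply/cvg_ex; exists (g x); exact: h_cvg.
  by apply: nearW => n; have /andP[] := hK n x.
apply/cvgrPdist_le => e e0.
have [n0 _ hn0] : \forall n \near \oo, g x - e < h_ n x.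
  by apply: (cvgr_gt _ (h_cvg x)); rewrite ltrBlDr ltrDl.
have := hn0 n0 (leqnn n0); rewrite -lte_fin => /(@h_lsc n0)[V].
move=> /nbhs_ballP[d /= d0 dV] hV.
near=> n.
have n0n : (n0 <= n)%N by near: n; exact: nbhs_infty_ge.
have nd : 2 * K / d <= n%:R by near: n; exact: nbhs_infty_ger.
have lo : g x - e <= lip_reg n%:R (h_ n) x.
  apply: lip_reg_ge => y; have [xy|xy] := ltP (mdist x y) d.
    have /hV : V y by apply: dV; rewrite ballEmdist.
    rewrite lte_fin => /ltW gy.
    rewrite (le_trans gy)// (le_trans (h_nd y _ _ n0n))// lerDl.
    by rewrite mulr_ge0// mdist_ge0.
  rewrite ler_pdivrMr// in nd.
  have : n%:R * d <= n%:R * mdist x y :> R by rewrite ler_wpM2l.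
  have := Kh n y; lra.
have := lip_reg_le x (ler0n _ n) (Kh n); have := h_le n x => hg lh.
by rewrite ler_norml; apply/andP; split; lra.
Unshelve. all: by end_near. Qed.

End lip_reg.

(** * Tails of extended real functions *)

Section tail.
Context {R : realType} {T : Type}.
Implicit Types (K : R) (f h : T -> \bar R).

(** The integrand of asymptotic uniform integrability, extended by zero so that it enters pointwise
    inequalities on the whole space. *)
Definition tail K h : T -> \bar R :=
  (fun s => `|h s|) \_ [set s | K%:E <= `|h s|].

Lemma tailE K h s : tail K h s = if K%:E <= `|h s| then `|h s| else 0.
Proof.
rewrite /tail patchE; case: ifPn => [/set_mem/= ->//|].
by rewrite notin_setE/= => /negP/negbTE ->.
Qed.

Lemma tail_ge0 K h s : 0 <= tail K h s.
Proof. by rewrite tailE; case: ifPn. Qed.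

(** Where [h] exceeds [K], so does [f], and its tail there is [f s] itself: one function controls
    the tails of all those below it. *)
Lemma le_tail_funepos K f h s : (0 <= K)%R -> h s <= f s -> K%:E < h s ->
  h s <= tail K f^\+ s.
Proof.
move=> K0 hf Kh; have h0 : 0 <= h s by rewrite (le_trans _ (ltW Kh))// lee_fin.
have f0 := le_trans h0 hf.
by rewrite tailE funeposE (max_l f0) gee0_abs// (le_trans (ltW Kh) hf).
Qed.

Lemma le_tail_funeneg K f h s : (0 <= K)%R -> f s <= h s -> h s < (- K)%:E ->
  - h s <= tail K f^\- s.
Proof.
move=> K0 fh hK; have := @le_tail_funepos K (\- f) (\- h) s K0.
by rewrite funeposN leeN2 => /(_ fh); apply; rewrite lteNr -EFinN.
Qed.

(** Truncating at [- K] only raises the value, so only the part above [K] must be compensated. *)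
Lemma le_clip_tail K h s : (0 <= K)%R ->
  h s <= (clip K (h s))%:E + tail K h^\+ s.
Proof.
move=> K0; have [hK|Kh] := leP (h s) K%:E.
  by rewrite lee_paddr ?tail_ge0// clipE// min_l// le_max lexx orbT.
rewrite lee_paddl ?le_tail_funepos// clipE// min_r ?(ltW Kh)//.
by rewrite le_max !lee_fin K0 orbT.
Qed.

(* The tail is subtracted on the left because [-oo + +oo = -oo]: with the tail
   added to [h s], the inequality fails when [h s = -oo]. *)
Lemma clip_tail_le K f h s : (0 <= K)%R -> f s <= h s ->
  (clip K (h s))%:E - tail K f^\- s <= h s.
Proof.
move=> K0 fh; have [Kh|hK] := leP (- K)%:E (h s).
  rewrite -[leRHS]sube0 leeB ?tail_ge0// clipE// ge_max -EFinN Kh.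
  by rewrite ge_min lexx.
rewrite -[leRHS]add0e -[X in 0 + X]oppeK leeB ?le_tail_funeneg//.
rewrite clipE// ge_max -EFinN lee_fin oppr_le0 K0 ge_min.
by rewrite (le_trans (ltW hK))// lee_fin oppr_le0.
Qed.

(** Large positive values of [h] are absorbed by the tail of [g], large negative ones by that of
    [f]. *)
Lemma abse_le_tail K f g h s : (0 <= K)%R -> f s <= h s -> h s <= g s ->
  `|h s| <= K%:E + (tail K g^\+ s + tail K f^\- s).
Proof.
move=> K0 fh hg; have [hK|] := leP `|h s| K%:E.
  by rewrite lee_paddr// adde_ge0// tail_ge0.
have [h0|h0] := leP 0 (h s).
  rewrite gee0_abs// => Kh; rewrite lee_paddl ?lee_fin//.
  by rewrite lee_paddr ?tail_ge0// le_tail_funepos.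
rewrite lte0_abs// => Kh; rewrite lee_paddl ?lee_fin//.
by rewrite lee_paddl ?tail_ge0// le_tail_funeneg// EFinN lteNr.
Qed.

End tail.

(** The limit superior is an infimum of suprema over neighbourhoods of infinity, so one of these
    suprema is below [a]. *)
Lemma limn_esup_lt (R : realType) (u : nat -> \bar R) (a : \bar R) :
  limn_esup u < a -> \forall n \near \oo, u n < a.
Proof.
rewrite /limn_esup limf_esupE => /ereal_inf_lt[_ [V nV <-]] ua.
apply: filterS nV => n Vn; apply: le_lt_trans ua.
by apply: ereal_sup_ubound; exists n.
Qed.

(** * Tail integrals and asymptotic uniform integrability *)

Section tail_integral.
Context d (T : measurableType d) (R : realType).
Implicit Types (K : R) (h : T -> \bar R).

Lemma measurable_tail K h : measurable_fun setT h ->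
  measurable_fun setT (tail K h).
Proof.
move=> mh; have ma : measurable_fun setT (fun s => `|h s|).
  exact: measurableT_comp.
have mK : measurable [set s | K%:E <= `|h s|].
  by rewrite -[X in measurable X]setTI; exact: emeasurable_fun_c_infty.
rewrite /tail; apply/(measurable_restrictT _ mK).
exact: measurable_funTS.
Qed.

(** The usable form of the hypothesis: the level [K] is chosen first, and the rank of [n] may depend
    on it. *)
Lemma aui_tail (mu_ : nat -> {measure set T -> \bar R}) h (e : R) :
  (0 < e)%R -> asymptotically_uniformly_integrable mu_ h ->
  \forall K \near +oo%R, \forall n \near \oo,
    \int[mu_ n]_s tail K h s < e%:E.
Proof.
move=> e0 aui; have e0' : 0 < e%:E by rewrite lte_fin.
have : \forall K \near +oo%R, limn_esup (fun n =>
    \int[mu_ n]_(s in [set s | K%:E <= `|h s|]) `|h s|) < e%:E.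
  exact: aui _ (open_ereal_lt' e0').
apply: filterS => K /limn_esup_lt; apply: filterS => n.
by rewrite integral_mkcond.
Qed.

Lemma integrable_tail (mu : {measure set T -> \bar R}) K h :
  measurable_fun setT h -> \int[mu]_s tail K h s < +oo ->
  mu.-integrable setT (tail K h).
Proof.
move=> mh fin; apply/integrableP; split; first exact: measurable_tail.
by under eq_integral do rewrite gee0_abs ?tail_ge0//.
Qed.

(** The majorant is that of [abse_le_tail]; its constant term is integrable because the measure is
    finite. *)
Lemma integrable_between (mu : {measure set T -> \bar R}) K f g h :
  (0 <= K)%R -> mu setT < +oo ->
  mu.-integrable setT (tail K g^\+) -> mu.-integrable setT (tail K f^\-) ->
  measurable_fun setT h -> (forall s, f s <= h s <= g s) ->
  mu.-integrable setT h.
Proof.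
move=> K0 mufin ig if_ mh fhg.
have icst : mu.-integrable setT (EFin \o cst K).
  by apply: measurable_bounded_integrable => //; exact: bounded_cst.
have := integrableD measurableT icst (integrableD measurableT ig if_).
apply: le_integrable => // s _; have /andP[fh hg] := fhg s.
by apply: le_trans (abse_le_tail K0 fh hg) _; exact: lee_abs.
Qed.

End tail_integral.

(** * Weak convergence and bounded continuous functions *)

Section weak_cvg.
Context {R : realType} {S : pmetricType R}.
Variables (mu_ : nat -> {measure set (borel S) -> \bar R}).
Variables (mu : {finite_measure set (borel S) -> \bar R}).
Hypothesis mu_cvg : weak_cvg mu_ mu.

Lemma le_bounded_fun (T : Type) (h : T -> R) K :
  (forall s, (`|h s| <= K)%R) -> bounded_fun h.
Proof.
move=> hK; exists K; split=> [|M KM s _ /=]; first exact: num_real.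
exact: le_trans (hK s) (ltW KM).
Qed.

Lemma integrable_bounded_continuous (nu : {measure set (borel S) -> \bar R})
    (h : S -> R) K :
  nu setT < +oo -> continuous h -> (forall s, (`|h s| <= K)%R) ->
  nu.-integrable setT (EFin \o h).
Proof.
move=> nufin ch hK; apply: measurable_bounded_integrable => //.
  exact: continuous_borel_measurable.
exact: le_bounded_fun hK.
Qed.

Lemma finite_measure_lty : mu setT < +oo.
Proof. by rewrite ltey_eq fin_num_measure. Qed.

(** The constant one is an admissible test function. *)
Lemma weak_cvg_setT : mu_ n setT @[n --> \oo] --> mu setT.
Proof.
have int1 (nu : {measure set (borel S) -> \bar R}) :
    \int[nu]_s (cst 1%R s)%:E = nu setT.
  exact: etrans (integral_cst nu measurableT 1%:E) (mul1e _).
have c1 : continuous (cst 1%R : S -> R) by exact: cst_continuous.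
have b1 : bounded_fun (cst 1%R : S -> R).
  by apply: (@le_bounded_fun _ _ 1%R) => s /=; rewrite normr1.
have := mu_cvg c1 b1.
by rewrite int1; under eq_fun do rewrite int1.
Qed.

Lemma weak_cvg_finite : \forall n \near \oo, mu_ n setT < +oo.
Proof. exact: weak_cvg_setT (open_ereal_lt' finite_measure_lty). Qed.

Lemma weak_cvg_bounded_continuous (h : S -> R) K :
  continuous h -> (forall s, (`|h s| <= K)%R) ->
  \int[mu_ n]_s (h s)%:E @[n --> \oo] --> \int[mu]_s (h s)%:E.
Proof.
by move=> ch hK; apply: mu_cvg => //; exact: le_bounded_fun hK.
Qed.

End weak_cvg.

(** Truncation of the identity. It carries [f_ n s --> f s] over to the truncations, infinite limits
    included. *)
Lemma clip_ereal_continuous (R : realType) (K : R) : (0 <= K)%R ->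
  continuous (clip K).
Proof.
move=> K0; apply: (@clip_continuous R _ id K K0) => x a ax.
  by exists [set y | a%:E < y] => //; exact: open_ereal_gt'.
by exists [set y | y < a%:E] => //; exact: open_ereal_lt'.
Qed.

Lemma cvge_near_le (R : realType) (u : nat -> \bar R) (l : R) :
  (forall e : R, (0 < e)%R ->
    \forall n \near \oo, (l - e)%:E <= u n <= (l + e)%:E) ->
  u @ \oo --> l%:E.
Proof.
move=> ul; apply/fine_cvgP; split.
  (* The bounds at [e = 1] make [u n] eventually finite. *)
  apply: filterS (ul 1%R ltr01) => n /andP[lu ul'].
  rewrite fin_numE -ltNye -ltey (lt_le_trans _ lu) ?ltNyr//.
  by rewrite (le_lt_trans ul') ?ltry.
apply/cvgrPdist_le => e /ul; apply: filterS => n /=.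
case: (u n) => [r| |] /=; rewrite ?leeNy_eq ?leye_eq ?andbF//.
by rewrite !lee_fin ler_norml => /andP[lr rl]; apply/andP; split; lra.
Qed.

(** * Integrability of the limit function *)

Section weak_limit.
Context {R : realType} {S : pmetricType R}.
Variables (mu_ : nat -> {measure set (borel S) -> \bar R}).
Variables (mu : {finite_measure set (borel S) -> \bar R}).
Hypothesis mu_cvg : weak_cvg mu_ mu.

Lemma weak_limit_integrable (g f : S -> \bar R) :
  measurable_fun [set: borel S] g ->
  lower_semicontinuous f -> upper_semicontinuous f ->
  (forall s, g s <= f s) ->
  asymptotically_uniformly_integrable mu_ g^\- ->
  asymptotically_uniformly_integrable mu_ f^\+ ->
  mu.-integrable [set: borel S] f.
Proof.
move=> mg lscf uscf gf g_aui f_aui.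
have mf : measurable_fun [set: borel S] f by exact: lsc_measurable.
have mgn : measurable_fun [set: borel S] g^\- by exact: measurable_funeneg.
have mfp : measurable_fun [set: borel S] f^\+ by exact: measurable_funepos.
near (pinfty_nbhs R) => K.
have K0 : (0 <= K)%R by near: K; exact: nbhs_pinfty_ge.
have tf : \forall n \near \oo, \int[mu_ n]_s tail K f^\+ s < 1%:E.
  by near: K; exact: aui_tail.
have tg : \forall n \near \oo, \int[mu_ n]_s tail K g^\- s < 1%:E.
  by near: K; exact: aui_tail.
have muT : mu setT = (fine (mu setT))%:E by rewrite fineK// fin_num_measure.
(* [K] times an eventual bound on the mass of [mu_ n], plus one for each tail. [K] is fixed before
   [M], so [C] is uniform in [M]. *)
pose C : \bar R := (K * (fine (mu setT) + 1) + 2)%:E.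
have muT1 : \forall n \near \oo, mu_ n setT < (fine (mu setT) + 1)%:E.
  have muT_lt : mu setT < (fine (mu setT) + 1)%:E.
    by rewrite {1}muT lte_fin ltrDl.
  exact: weak_cvg_setT mu_cvg _ (open_ereal_lt' muT_lt).
have clip_C (M : nat) : \int[mu]_s `|(clip M%:R (f s))%:E| <= C.
  have cc : continuous (fun s => `|clip M%:R (f s)|%R).
    move=> s; apply: cvg_norm.
    exact: (@clip_continuous _ _ f M%:R).
  have cb s : (`| `|clip M%:R (f s)| | <= M%:R :> R)%R.
    by rewrite normr_id clip_norm.
  have cv := weak_cvg_bounded_continuous mu_cvg cc cb.
  rewrite -(cvg_lim _ cv)//; apply: lime_le.
    by apply/cvg_ex; eexists; exact: cv.
  near=> n.
  have icst : \int[mu_ n]_s (cst K%:E s) = K%:E * mu_ n setT.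
    exact: integral_cst.
  have tfn : \int[mu_ n]_s tail K f^\+ s < 1%:E by near: n.
  have tgn : \int[mu_ n]_s tail K g^\- s < 1%:E by near: n.
  have mtf : measurable_fun setT (tail K f^\+ : borel S -> \bar R).
    exact: measurable_tail.
  have mtg : measurable_fun setT (tail K g^\- : borel S -> \bar R).
    exact: measurable_tail.
  have : \int[mu_ n]_s (K%:E + (tail K f^\+ s + tail K g^\- s)) <= C.
    rewrite (@ge0_integralD _ _ _ _ _ _ (cst K%:E))//; last 2 first.
    - by move=> s _; rewrite adde_ge0// tail_ge0.
    - exact: emeasurable_funD.
    rewrite ge0_integralD//; last 2 first.
    - by move=> s _; exact: tail_ge0.
    - by move=> s _; exact: tail_ge0.
    rewrite icst /C EFinD EFinM; apply: leeD.
      by rewrite lee_wpmul2l ?lee_fin// ltW//; near: n.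
    have -> : 2%:E = 1%:E + 1%:E :> \bar R by rewrite -EFinD.
    by apply: leeD; exact: ltW.
  apply: le_trans; apply: ge0_le_integral => //.
  - apply: measurableT_comp => //.
    exact: (@continuous_borel_measurable _ _ (fun s => `|clip M%:R (f s)|%R)).
  - by apply: emeasurable_funD => //; exact: emeasurable_funD.
  (* [f] lies between [g] and itself. *)
  - move=> s _; apply: le_trans (abse_le_tail K0 (gf s) (lexx _)).
    exact: abse_clip_le.
apply/integrableP; split=> //; apply: (@le_lt_trans _ _ C); last exact: ltry.
have cvg_abs s : `|(clip n%:R (f s))%:E| @[n --> \oo] --> `|f s|.
  by apply: cvg_abse; exact: cvg_clip.
(* Fatou, since no integrable majorant of the truncations is known yet. *)
have fatou_le := @fatou _ _ _ mu setT measurableT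
  (fun n s => `|(clip n%:R (f s))%:E|) _ _.
apply: (@le_trans _ _
  (\int[mu]_s limn_einf (fun n => `|(clip n%:R (f s))%:E|))).
  by under [leRHS]eq_integral do rewrite (cvg_limn_einf_sup (cvg_abs _)).1.
apply: le_trans (fatou_le _ _) _ => [n|n s _|]; last 1 first.
- rewrite limn_einf_lim; apply: lime_le; first exact: is_cvg_einfs.
  apply: nearW => n; apply: le_trans (clip_C n).
  by apply: ereal_inf_lbound; exists n => //=.
- apply: measurableT_comp => //; apply/measurable_EFinP.
  apply: (@continuous_borel_measurable _ _ (fun s => clip n%:R (f s))).
  exact: clip_continuous.
- exact: abse_ge0.
Unshelve. all: by end_near. Qed.

End weak_limit.

(** * Convergence of the integrals *)

Lemma integral_clip_cvg d (T : measurableType d) (R : realType)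
    (mu : {measure set T -> \bar R}) (f : T -> \bar R) :
  mu.-integrable setT f ->
  (forall n : nat, measurable_fun setT (clip n%:R \o f)) ->
  \int[mu]_s (clip n%:R (f s))%:E @[n --> \oo] --> \int[mu]_s f s.
Proof.
move=> fi mc; have /integrableP[mf _] := fi.
have [] // := @dominated_convergence _ _ _ mu setT measurableT
  (fun n s => (clip n%:R (f s))%:E) f (abse \o f) _ mf _ _ _.
- by move=> n; apply/measurable_EFinP; exact: mc.
- by apply: aeW => s _; exact: cvg_clip.
- exact: integrable_abse.
- by apply: aeW => s n _; exact: abse_clip_le.
Qed.

(** Indices start at zero, so [f_ 0] is the first function. [\int] always has a value, so that the
    limit integral is defined is asserted separately. *)
Theorem theorem6p1 (R : realType) (S : pmetricType R)
    (mu_ : nat -> {measure set (borel S) -> \bar R})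
    (mu : {finite_measure set (borel S) -> \bar R})
    (f_ : nat -> S -> \bar R) (f : S -> \bar R)
    (mu_cvg : weak_cvg mu_ mu)
    (f_lsc : forall n, lower_semicontinuous (f_ n))
    (f_nd : forall n s, f_ n s <= f_ n.+1 s)
    (f_lim : forall s, f_ n s @[n --> \oo] --> f s)
    (f_int : forall n, integral_defined (mu_ n) (f_ n))
    (f_usc : upper_semicontinuous f)
    (f0_aui : asymptotically_uniformly_integrable mu_ (f_ 0%N)^\-)
    (f_aui : asymptotically_uniformly_integrable mu_ f^\+) :
  integral_defined mu f /\
  \int[mu_ n]_s f_ n s @[n --> \oo] --> \int[mu]_s f s.
Proof.
have [lscf f_le] := nondecreasing_cvg_lsc f_lsc f_nd f_lim.
have nd s : nondecreasing_seq (f_ ^~ s) by exact/nondecreasing_seqP.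
have mf_ n : measurable_fun [set: borel S] (f_ n) by exact: lsc_measurable.
have mf : measurable_fun [set: borel S] f by exact: lsc_measurable.
have mf0 : measurable_fun [set: borel S] (f_ 0%N)^\-.
  exact: measurable_funeneg.
have mfp : measurable_fun [set: borel S] f^\+ by exact: measurable_funepos.
have fi : mu.-integrable [set: borel S] f.
  exact: (weak_limit_integrable mu_cvg (mf_ 0%N)).
split.
  by rewrite /integral_defined gt_min ltey_eq integrable_pos_fin_num.
have If : \int[mu]_s f s = (fine (\int[mu]_s f s))%:E.
  by rewrite fineK// integrable_fin_num.
rewrite If; set l := fine _ in If *; apply: cvge_near_le => e3 e30.
pose e := (e3 / 3)%R.
have e0 : (0 < e)%R by rewrite divr_gt0.
have cf (K : nat) : continuous (clip K%:R \o f) by exact: clip_continuous.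
have clip_cvg : \int[mu]_s (clip n%:R (f s))%:E @[n --> \oo] --> l%:E.
  rewrite -If; apply: integral_clip_cvg => // n.
  exact: continuous_borel_measurable.
(* These strict bounds are open conditions: they pass unchanged to the truncation, to [phi m] and to
   [mu_ n], and the remaining [e]'s cover the tail. *)
have le_l : (l - e)%:E < l%:E by rewrite lte_fin; lra.
have l_le : l%:E < (l + e)%:E by rewrite lte_fin; lra.
(* The level is fixed first, then [m], then [n]. It is a natural number, to share its index with
   [clip_cvg]. *)
near \oo => k.
pose K : R := k%:R.
have K0 : (0 <= K)%R by [].
have tf : \forall n \near \oo, \int[mu_ n]_s tail K f^\+ s < e%:E.
  rewrite /K; near: k; exact: cvgr_idn (aui_tail e0 f_aui).
have t0 : \forall n \near \oo, \int[mu_ n]_s tail K (f_ 0%N)^\- s < e%:E.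
  rewrite /K; near: k; exact: cvgr_idn (aui_tail e0 f0_aui).
have lK : (l - e)%:E < \int[mu]_s (clip K (f s))%:E.
  rewrite /K; near: k; exact: clip_cvg (open_ereal_gt' le_l).
have Kl : \int[mu]_s (clip K (f s))%:E < (l + e)%:E.
  rewrite /K; near: k; exact: clip_cvg (open_ereal_lt' l_le).
have clipK s : (`|clip K (f s)| <= K)%R by exact: clip_norm.
pose g n s := clip K (f_ n s).
have gK n s : (- K <= g n s <= K)%R by exact: clip_itv.
have Kg n s : (- K <= g n s)%R by have /andP[] := gK n s.
pose phi m : S -> R := lip_reg m%:R (g m).
have cphi m : continuous (phi m) by exact: (lip_reg_continuous _ (Kg m)).
have phi_le m s : (phi m s <= g m s)%R by exact: (lip_reg_le _ _ (Kg m)).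
have phiK m s : (`|phi m s| <= K)%R.
  rewrite ler_norml (le_trans (phi_le m s))// ?andbT; last first.
    by have /andP[] := gK m s.
  by apply: lip_reg_ge => y; rewrite ler_wpDr// mulr_ge0// mdist_ge0.
have phi_cvg s : phi m s @[m --> \oo] --> clip K (f s).
  apply: (@lip_reg_cvg _ _ g (fun s => clip K (f s)) K gK) => {s} [n|s|s].
  - exact: clip_lsc.
  - by move=> m n mn; apply: le_clip => //; exact: nd.
  - apply: (cvg_comp _ _ (f_lim s)); exact: clip_ereal_continuous.
have int_phi : \int[mu]_s (phi m s)%:E @[m --> \oo] -->
    \int[mu]_s (clip K (f s))%:E.
  apply: (@dominated_cvg _ _ _ mu setT measurableT
    (fun m s => (phi m s)%:E) _ (cst K%:E)) => //.
  - by move=> m; apply/measurable_EFinP; exact: continuous_borel_measurable.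
  - by move=> s _; apply: cvg_EFin; [exact: nearW|exact: phi_cvg].
  - exact: finite_measure_integrable_cst.
  - by move=> m s _; rewrite lee_fin.
near \oo => m.
have lphi : (l - e)%:E < \int[mu]_s (phi m s)%:E.
  by near: m; exact: int_phi (open_ereal_gt' lK).
have cvg_clipK := weak_cvg_bounded_continuous mu_cvg (cf k) clipK.
have cvg_phi := weak_cvg_bounded_continuous mu_cvg (cphi m) (phiK m).
near=> n.
have mun : mu_ n setT < +oo by near: n; exact: weak_cvg_finite mu_cvg.
have mn : (m <= n)%N by near: n; exact: nbhs_infty_ge.
have tfn : \int[mu_ n]_s tail K f^\+ s < e%:E by near: n.
have t0n : \int[mu_ n]_s tail K (f_ 0%N)^\- s < e%:E by near: n.
have clipn : \int[mu_ n]_s (clip K (f s))%:E < (l + e)%:E.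
  near: n; exact: cvg_clipK (open_ereal_lt' Kl).
have phin : (l - e)%:E < \int[mu_ n]_s (phi m s)%:E.
  near: n; exact: cvg_phi (open_ereal_gt' lphi).
have itf : (mu_ n).-integrable setT (tail K f^\+ : borel S -> \bar R).
  by apply: integrable_tail => //; apply: lt_trans tfn (ltry _).
have it0 : (mu_ n).-integrable setT (tail K (f_ 0%N)^\- : borel S -> \bar R).
  by apply: integrable_tail => //; apply: lt_trans t0n (ltry _).
(* Squeezed between [f_ 0] and [f]; integrability lets the pointwise bounds be integrated. *)
have ifn : (mu_ n).-integrable [set: borel S] (f_ n).
  apply: (integrable_between K0 mun itf it0 (mf_ n)) => s.
  by rewrite f_le andbT nd.
have icl : (mu_ n).-integrable [set: borel S] (EFin \o (clip K \o f)).
  exact: (integrable_bounded_continuous mun (cf k) clipK).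
have iphi : (mu_ n).-integrable [set: borel S] (EFin \o phi m).
  exact: (integrable_bounded_continuous mun (cphi m) (phiK m)).
apply/andP; split.
(* Lower bound: [phi m <= clip K (f_ m) <= clip K (f_ n)] as [m <= n], and the tail accounts for
   values below [- K]. *)
- apply: (@le_trans _ _
    (\int[mu_ n]_s ((phi m s)%:E - tail K (f_ 0%N)^\- s))).
    rewrite integralB//.
    have -> : (l - e3)%:E = (l - e - e)%:E - e%:E.
      by rewrite -EFinB; congr (_%:E); rewrite /e; lra.
    by apply: leeB; rewrite ?ltW// (le_lt_trans _ phin)// lee_fin; lra.
  apply: le_integral => //; first exact: integrableB.
  move=> s _.
  apply: le_trans (@clip_tail_le _ _ K (f_ 0%N) (f_ n) s K0 (nd s _ _ _)) => //.
  rewrite leeB// lee_fin (le_trans (phi_le m s))//.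
  by apply: le_clip => //; exact: nd.
(* Upper bound: [f_ n <= f], and [f] is at most its truncation plus its positive tail. *)
- apply: (@le_trans _ _
    (\int[mu_ n]_s ((clip K (f s))%:E + tail K f^\+ s))).
    apply: le_integral => //; first exact: integrableD.
    move=> s _; by apply: le_trans (f_le n s) _; exact: le_clip_tail.
  rewrite integralD//.
  have -> : (l + e3)%:E = (l + e + e)%:E + e%:E.
    by rewrite -EFinD; congr (_%:E); rewrite /e; lra.
  by apply: leeD; rewrite ?ltW// (lt_le_trans clipn)// lee_fin; lra.
Unshelve. all: by end_near. Qed.
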